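(* Let $\{X_n\}_{n\in\mathbb{N}}$ be a family of strictly convex real Banach spaces with $\dim(X_n)\geq 2$ for all $n$. Then for every $n\geq 2$ the Banach space $X_1\oplus_\infty\cdots\oplus_\infty X_n$ satisfies the Mazur--Ulam property, and the Banach space $\bigoplus^{c_0}_{n\in\mathbb{N}}X_n$ satisfies the Mazur--Ulam property.
   Context: All Banach spaces are real. $X_1\oplus_\infty\cdots\oplus_\infty X_n$ is the product $X_1\times\cdots\times X_n$ with norm $\|(x_1,\dots,x_n)\|=\max_i\|x_i\|$. $\bigoplus^{c_0}_{n\in\mathbb{N}}X_n$ is the space of sequences $(x_n)$ with $x_n\in X_n$ and $\|x_n\|\to 0$, with the sup norm. A Banach space is strictly convex if every point of its unit sphere is an extreme point of its closed unit ball. A Banach space $Z$ satisfies the Mazur--Ulam property if for every Banach space $Y$, every surjective isometry $\Delta:S_Z\to S_Y$ between the unit spheres admits an extension to a surjective real-linear isometry from $Z$ onto $Y$. *)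

(* Defs.v *)
From HB Require Import structures.
From mathcomp Require Import all_boot all_order all_algebra.
From mathcomp Require Import all_classical all_reals all_analysis.

Set Implicit Arguments.
Unset Strict Implicit.
Unset Printing Implicit Defensive.

Import Order.TTheory GRing.Theory Num.Theory.
Import numFieldNormedType.Exports.

Local Open Scope classical_set_scope.
Local Open Scope ring_scope.

Section Notions.
Context {R : realType}.

Definition unit_sphere (V : normedModType R) : set V := [set x | `|x| = 1].

Arguments unit_sphere : clear implicits.

Definition closed_unit_ball (V : normedModType R) : set V := [set x | `|x| <= 1].

Arguments closed_unit_ball : clear implicits.

Definition extreme_point {V : lmodType R} (C : set V) (x : V) : Prop :=
  C x /\ forall (y z : V) (t : R), C y -> C z -> 0 < t < 1 ->
    x = t *: y + (1 - t) *: z -> y = z.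

Definition strictly_convex (V : normedModType R) : Prop :=
  forall x : V, unit_sphere V x -> extreme_point (closed_unit_ball V) x.

Definition dim_ge2 (V : lmodType R) : Prop :=
  exists x y : V, forall a b : R, a *: x + b *: y = 0 -> a = 0 /\ b = 0.

(* Mazur--Ulam property: every surjective isometry between unit spheres
   S_Z -> S_Y (Y any real Banach space) extends to a surjective real-linear
   isometry Z -> Y.  A map S_Z -> S_Y is represented by a map D : Z -> Y whose
   values outside S_Z are irrelevant. *)
Definition Mazur_Ulam_property (Z : normedModType R) : Prop :=
  forall (Y : completeNormedModType R) (D : Z -> Y),
    (forall x, unit_sphere Z x -> unit_sphere Y (D x)) ->
    (forall y, unit_sphere Y y -> exists2 x, unit_sphere Z x & D x = y) ->
    (forall x y, unit_sphere Z x -> unit_sphere Z y -> `|D x - D y| = `|x - y|) ->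
    exists T : {linear Z -> Y},
      [/\ forall y : Y, exists x : Z, T x = y,
          forall x : Z, `|T x| = `|x| &
          forall x : Z, unit_sphere Z x -> T x = D x].

End Notions.

Section LinfSum.
Context {R : realType} (X : nat -> normedModType R) (n : nat).

Definition linf_sum := forall i : 'I_n, X i.

HB.instance Definition _ := gen_eqMixin linf_sum.
HB.instance Definition _ := gen_choiceMixin linf_sum.

Let zero : linf_sum := fun i => 0.
Let add (x y : linf_sum) : linf_sum := fun i => x i + y i.
Let opp (x : linf_sum) : linf_sum := fun i => - x i.
Let scale (a : R) (x : linf_sum) : linf_sum := fun i => a *: x i.

Let addA : associative add.
Proof. by move=> x y z; apply: functional_extensionality_dep => i; rewrite /add addrA. Qed.
Let addC : commutative add.
Proof. by move=> x y; apply: functional_extensionality_dep => i; rewrite /add addrC. Qed.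
Let add0 : left_id zero add.
Proof. by move=> x; apply: functional_extensionality_dep => i; rewrite /add /zero add0r. Qed.
Let addN : left_inverse zero opp add.
Proof. by move=> x; apply: functional_extensionality_dep => i; rewrite /add /opp /zero addNr. Qed.

HB.instance Definition _ := GRing.isZmodule.Build linf_sum addA addC add0 addN.

Let scaleA a b (x : linf_sum) : scale a (scale b x) = scale (a * b) x.
Proof. by apply: functional_extensionality_dep => i; rewrite /scale scalerA. Qed.
Let scale1 : left_id 1 scale.
Proof. by move=> x; apply: functional_extensionality_dep => i; rewrite /scale scale1r. Qed.
Let scaleDr : right_distributive scale +%R.
Proof. by move=> a x y; apply: functional_extensionality_dep => i; rewrite /scale scalerDr. Qed.
Let scaleDl (x : linf_sum) : {morph scale^~ x : a b / a + b}.
Proof. by move=> a b; apply: functional_extensionality_dep => i; rewrite /scale scalerDl. Qed.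

HB.instance Definition _ := GRing.Zmodule_isLmodule.Build R linf_sum
  scaleA scale1 scaleDr scaleDl.

Definition linf_norm (x : linf_sum) : R := \big[Num.max/0]_(i < n) `|x i|.

Let norm_ge (x : linf_sum) i : `|x i| <= linf_norm x.
Proof. exact: (le_bigmax 0 (fun i => `|x i|)). Qed.

Let norm_ge0 (x : linf_sum) : 0 <= linf_norm x.
Proof. by rewrite /linf_norm; elim/big_ind: _ => //= a b ha hb; rewrite le_max ha. Qed.

Let normD (x y : linf_sum) : linf_norm (x + y) <= linf_norm x + linf_norm y.
Proof.
apply: bigmax_le => [|i _]; first by rewrite addr_ge0.
by rewrite (le_trans (ler_normD _ _)) // lerD.
Qed.

Let normZ (a : R) (x : linf_sum) : linf_norm (a *: x) = `|a| * linf_norm x.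
Proof.
rewrite /linf_norm (big_endo (fun r => `|a| * r)) ?mulr0 //.
  by apply: eq_bigr => i _; rewrite normrZ.
by move=> r s; rewrite maxr_pMr.
Qed.

Let norm0 (x : linf_sum) : linf_norm x = 0 -> x = 0.
Proof.
move=> x0; apply: functional_extensionality_dep => i.
by apply/normr0_eq0/eqP; rewrite eq_le normr_ge0 -x0 norm_ge.
Qed.

HB.instance Definition _ := Lmodule_isNormed.Build R linf_sum normD normZ norm0.

End LinfSum.

Section C0Sum.
Context {R : realType} (X : nat -> normedModType R).

Record c0_sum := C0sum {
  c0val : forall k : nat, X k ;
  c0valP : (fun k => `|c0val k|) @ \oo --> (0 : R) }.

Lemma c0_sum_inj (x y : c0_sum) : c0val x = c0val y -> x = y.
Proof.
case: x => f Pf; case: y => g Pg /= fg; subst g.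
by rewrite (Prop_irrelevance Pf Pg).
Qed.

HB.instance Definition _ := gen_eqMixin c0_sum.
HB.instance Definition _ := gen_choiceMixin c0_sum.

Let c0E (f : forall k, X k) :
  (fun k => `|f k|) @ \oo --> (0 : R) <->
  forall e : R, 0 < e -> \forall k \near \oo, `|f k| < e.
Proof.
rewrite cvgr0Pnorm_lt; split => H e e0; have := H e e0;
  by apply: filterS => k; rewrite ger0_norm.
Qed.

Let zeroP : (fun k => `|(0 : X k)|) @ \oo --> (0 : R).
Proof. by apply/c0E => e e0; near=> k; rewrite normr0. Unshelve. all: by end_near. Qed.

Let addP (x y : c0_sum) :
  (fun k => `|c0val x k + c0val y k|) @ \oo --> (0 : R).
Proof.
apply/c0E => e e0.
have /c0E/(_ (e / 2)) := c0valP x; have /c0E/(_ (e / 2)) := c0valP y.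
rewrite divr_gt0 // => /(_ isT) Hy /(_ isT) Hx.
near=> k; rewrite (le_lt_trans (ler_normD _ _)) // (splitr e) ltrD //.
  by near: k.
by near: k.
Unshelve. all: by end_near.
Qed.

Let oppP (x : c0_sum) : (fun k => `|- c0val x k|) @ \oo --> (0 : R).
Proof.
have -> : (fun k => `|- c0val x k|) = (fun k => `|c0val x k|).
  by apply: funext => k; rewrite normrN.
exact: c0valP.
Qed.

Let scaleP (a : R) (x : c0_sum) : (fun k => `|a *: c0val x k|) @ \oo --> (0 : R).
Proof.
have -> : (fun k => `|a *: c0val x k|) = (fun k => `|a| * `|c0val x k|).
  by apply: funext => k; rewrite normrZ.
rewrite -(mulr0 `|a|); apply: cvgM; [exact: cvg_cst | exact: c0valP].
Qed.

Let zero : c0_sum := C0sum zeroP.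
Let add (x y : c0_sum) : c0_sum := C0sum (addP x y).
Let opp (x : c0_sum) : c0_sum := C0sum (oppP x).
Let scale (a : R) (x : c0_sum) : c0_sum := C0sum (scaleP a x).

Let addA : associative add.
Proof. by move=> x y z; apply: c0_sum_inj; apply: functional_extensionality_dep => i; rewrite /= addrA. Qed.
Let addC : commutative add.
Proof. by move=> x y; apply: c0_sum_inj; apply: functional_extensionality_dep => i; rewrite /= addrC. Qed.
Let add0 : left_id zero add.
Proof. by move=> x; apply: c0_sum_inj; apply: functional_extensionality_dep => i; rewrite /= add0r. Qed.
Let addN : left_inverse zero opp add.
Proof. by move=> x; apply: c0_sum_inj; apply: functional_extensionality_dep => i; rewrite /= addNr. Qed.

HB.instance Definition _ := GRing.isZmodule.Build c0_sum addA addC add0 addN.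

Let scaleA a b (x : c0_sum) : scale a (scale b x) = scale (a * b) x.
Proof. by apply: c0_sum_inj; apply: functional_extensionality_dep => i; rewrite /= scalerA. Qed.
Let scale1 : left_id 1 scale.
Proof. by move=> x; apply: c0_sum_inj; apply: functional_extensionality_dep => i; rewrite /= scale1r. Qed.
Let scaleDr : right_distributive scale +%R.
Proof. by move=> a x y; apply: c0_sum_inj; apply: functional_extensionality_dep => i; rewrite /= scalerDr. Qed.
Let scaleDl (x : c0_sum) : {morph scale^~ x : a b / a + b}.
Proof. by move=> a b; apply: c0_sum_inj; apply: functional_extensionality_dep => i; rewrite /= scalerDl. Qed.

HB.instance Definition _ := GRing.Zmodule_isLmodule.Build R c0_sum
  scaleA scale1 scaleDr scaleDl.

Definition c0_norm (x : c0_sum) : R := sup (range (fun k => `|c0val x k|)).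

Let c0_has_sup (x : c0_sum) : has_sup (range (fun k => `|c0val x k|)).
Proof.
split; first by exists `|c0val x 0|, 0%N.
have /c0E/(_ 1 ltr01) [N _ HN] := c0valP x.
exists (1 + \sum_(k < N) `|c0val x k|) => _ [k _ <-].
case: (ltnP k N) => kN.
  rewrite ler_wpDl // (bigD1 (Ordinal kN)) //= ler_wpDr //.
  by apply: sumr_ge0 => i _.
by rewrite ler_wpDr ?sumr_ge0 // ltW // HN.
Qed.

Let norm_ge (x : c0_sum) k : `|c0val x k| <= c0_norm x.
Proof. by apply: sup_upper_bound; [exact: c0_has_sup | exists k]. Qed.

Let norm_ge0 (x : c0_sum) : 0 <= c0_norm x.
Proof. exact: le_trans (norm_ge x 0). Qed.

Let normD (x y : c0_sum) : c0_norm (x + y) <= c0_norm x + c0_norm y.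
Proof.
apply: ge_sup; first by exists `|c0val (x + y) 0|, 0%N.
move=> _ [k _ <-] /=.
by rewrite (le_trans (ler_normD _ _)) // lerD.
Qed.

Let normZ (a : R) (x : c0_sum) : c0_norm (a *: x) = `|a| * c0_norm x.
Proof.
apply/eqP; rewrite eq_le; apply/andP; split.
  apply: ge_sup; first by exists `|c0val (a *: x) 0|, 0%N.
  move=> _ [k _ <-] /=; rewrite (_ : `|c0val (a *: x) k| = `|a *: c0val x k|) //.
  by rewrite normrZ; apply: ler_wpM2l => //; exact: norm_ge.
have [->|a0] := eqVneq a 0; first by rewrite normr0 mul0r norm_ge0.
rewrite -ler_pdivlMl ?normr_gt0 //.
apply: ge_sup; first by exists `|c0val x 0|, 0%N.
move=> _ [k _ <-] /=.
rewrite ler_pdivlMl ?normr_gt0 // -normrZ.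
exact: (norm_ge (a *: x) k).
Qed.

Let norm0 (x : c0_sum) : c0_norm x = 0 -> x = 0.
Proof.
move=> x0; apply: c0_sum_inj; apply: functional_extensionality_dep => i.
by apply/normr0_eq0/eqP; rewrite eq_le normr_ge0 -x0 norm_ge.
Qed.

HB.instance Definition _ := Lmodule_isNormed.Build R c0_sum normD normZ norm0.

End C0Sum.

(* Main.v *)
Require Import Defs.
From HB Require Import structures.
From mathcomp Require Import all_boot all_order all_algebra.
From mathcomp Require Import all_classical all_reals all_analysis.
From mathcomp Require Import ring lra.

Import Order.TTheory GRing.Theory Num.Theory.
Import numFieldNormedType.Exports.
Local Open Scope classical_set_scope.
Local Open Scope ring_scope.

(* Let D be a surjective isometry from the unit sphere of the sum Z onto that of
   Y, and for a unit vector e of X k let F(k, e) be the face of unit vectors of Z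
   whose k-th coordinate is e.  By strict convexity F(k, e) consists of the unit
   vectors at distance 2 from the vector with k-th coordinate -e and all others
   0; playing with this description shows that D(F(k, e)) is convex and that
   -D(F(k, e)) = D(F(k, -e)).

   Moving the k-th coordinate of x to u costs exactly |x_k - u|, so convexity of
   the images of the faces gives, for x and y in a common face and m the point
   with D m = (1 - t) D x + t D y, that
   |m_k - u| <= (1 - t) |x_k - u| + t |y_k - u| for all k and all unit u.  Taking
   for u the two unit vectors on the line through x_k and y_k, strict convexity
   forces m_k = (1 - t) x_k + t y_k.  So D is affine on each face; the same
   argument shows that D is odd.

   Finally let T be the positively homogeneous extension of D.  Affinity and
   oddness give D(e + z) = D e + T z for e a unit vector in coordinate j and z in
   the unit ball with z_j = 0.  Hence T is additive on {z_j = 0} for every j, and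
   T x = T x_j + T(x - x_j) where x attains its norm at j; two distinct indices
   are then enough to glue these into linearity of T. *)

(** * Strict convexity and tangent balls *)

Section StrictConvexity.
Context {R : realType} (E : normedModType R).

(** Intermediate value theorem along the ray, up to the parameter 2/|v|, where the norm is at least
    2 - 1. *)
Lemma ray_meets_unit_sphere (x v : E) : `|x| <= 1 -> v != 0 ->
  exists2 s : R, 0 <= s & `|x + s *: v| = 1.
Proof.
move=> x1 v0; have nv : 0 < `|v| by rewrite normr_gt0.
pose f (s : R) := `|x + s *: v|.
have M0 : 0 <= 2 / `|v| by rewrite divr_ge0.
have cf : {within `[0, 2 / `|v|], continuous f}.
  apply: continuous_subspaceT => s; apply: cvg_norm.
  by apply: cvgD; [exact: cvg_cst | apply: cvgZr_tmp; exact: cvg_id].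
have fM : 1 <= f (2 / `|v|).
  rewrite /f addrC -[x]opprK; apply: le_trans (lerB_dist _ _).
  rewrite normrN normrZ ger0_norm // divfK ?gt_eqF //; lra.
have [] := IVT M0 cf (v := 1).
  rewrite /f scale0r addr0 ge_min x1 /= le_max; apply/orP; right; exact: fM.
by move=> s; rewrite in_itv /= => /andP[s0 _] fs; exists s.
Qed.

Hypothesis scE : strictly_convex E.

Lemma strictly_convex_combination (y z : E) (r t : R) : 0 < r -> 0 < t < 1 ->
  `|y| <= r -> `|z| <= r -> `|t *: y + (1 - t) *: z| = r -> y = z.
Proof.
move=> r0 t01 yr zr yzr.
have nr (x : E) : `|r^-1 *: x| = `|x| / r.
  by rewrite normrZ gtr0_norm ?invr_gt0 // mulrC.
have le1 (x : E) : `|x| <= r -> `|r^-1 *: x| <= 1.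
  by move=> xr; rewrite nr ler_pdivrMr // mul1r.
have /scE[_ /(_ _ _ t (le1 y yr) (le1 z zr) t01)] :
    `|r^-1 *: (t *: y + (1 - t) *: z)| = 1.
  by rewrite nr yzr divff ?gt_eqF.
rewrite scalerDr !scalerA ![r^-1 * _]mulrC => /(_ erefl).
by apply: scalerI; rewrite invr_eq0 gt_eqF.
Qed.

(** For positive a and b, the bounds put v - d/a and v + d/b in the ball of radius |v|. Their
    combination with weights a/(a+b) and b/(a+b) is v, so the two points coincide. *)
Lemma strictly_convex_touching_balls (d v : E) (a b : R) :
  v != 0 -> 0 <= a -> 0 <= b ->
  `|d - a *: v| <= a * `|v| -> `|d + b *: v| <= b * `|v| -> d = 0.
Proof.
move=> v0 a_ge0 b_ge0; have [->|a_neq0] := eqVneq a 0.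
  by rewrite mul0r scale0r subr0 normr_le0 => /eqP.
have [->|b_neq0] := eqVneq b 0.
  by rewrite mul0r scale0r addr0 normr_le0 => _ /eqP.
have a0 : 0 < a by rewrite lt_neqAle eq_sym a_neq0.
have b0 : 0 < b by rewrite lt_neqAle eq_sym b_neq0.
move=> da db.
have ab0 : 0 < a + b by rewrite addr_gt0.
have := @strictly_convex_combination (v - a^-1 *: d) (v + b^-1 *: d) `|v|
  (a / (a + b)).
have -> : 1 - a / (a + b) = b / (a + b) by field; rewrite gt_eqF.
rewrite normr_gt0 v0 => /(_ isT) H.
have /H{}H : 0 < a / (a + b) < 1.
  by rewrite divr_gt0 //= ltr_pdivrMr // mul1r ltrDl.
have /H{}H : `|v - a^-1 *: d| <= `|v|.
  rewrite -(ler_pM2l a0) -{1}(gtr0_norm a0) -normrZ scalerBr scalerA.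
  by rewrite divff ?gt_eqF // scale1r distrC.
have /H{}H : `|v + b^-1 *: d| <= `|v|.
  rewrite -(ler_pM2l b0) -{1}(gtr0_norm b0) -normrZ scalerDr scalerA.
  by rewrite divff ?gt_eqF // scale1r addrC.
have /H : `|(a / (a + b)) *: (v - a^-1 *: d)
    + (b / (a + b)) *: (v + b^-1 *: d)| = `|v|.
  congr `| _ |; rewrite scalerBr scalerDr !scalerA.
  have -> : a / (a + b) / a = (a + b)^-1 by field; rewrite !gt_eqF.
  have -> : b / (a + b) / b = (a + b)^-1 by field; rewrite !gt_eqF.
  by rewrite addrACA addNr addr0 -scalerDl -mulrDl divff ?gt_eqF // scale1r.
move=> /addrI/eqP; rewrite eq_sym -addr_eq0 -scalerDl scaler_eq0.
by rewrite gt_eqF ?addr_gt0 ?invr_gt0 //= => /eqP.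
Qed.

(* The line through x and y (any line, if x = y) leaves the ball at two unit
   vectors; the balls around them given by the hypothesis touch at the convex
   combination of x and y. *)
Lemma strictly_convex_determined (w x y m : E) (t : R) :
  w != 0 -> 0 <= t <= 1 -> `|x| <= 1 -> `|y| <= 1 ->
  (forall u : E, `|u| = 1 ->
    `|m - u| <= (1 - t) * `|x - u| + t * `|y - u|) ->
  m = (1 - t) *: x + t *: y.
Proof.
move=> w0 /andP[t0 t1] x1 y1 H.
have [v [a [v0 a0 yE]]] : exists v a, [/\ v != 0, 0 <= a & y = x + a *: v].
  have [<-|xy] := eqVneq x y; first by exists w, 0; rewrite scale0r addr0.
  by exists (y - x), 1; rewrite scale1r subrKC subr_eq0 eq_sym.
have [s s0 us] := ray_meets_unit_sphere y v y1 v0.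
have nv0 : - v != 0 by rewrite oppr_eq0.
have [r r0 ur] := ray_meets_unit_sphere x (- v) x1 nv0.
have cE : (1 - t) *: x + t *: y = x + (t * a) *: v.
  by rewrite yE scalerDr (scalerA t a) addrA -(scalerDl x) subrK scale1r.
apply/eqP; rewrite -subr_eq0; apply/eqP.
(* With c the convex combination, the two unit vectors are c + (s + (1 - t)a)v and c - (r + ta)v. *)
apply: (@strictly_convex_touching_balls _ v (s + (1 - t) * a) (r + t * a)) => //.
- by rewrite addr_ge0 // mulr_ge0 // subr_ge0.
- by rewrite addr_ge0 // mulr_ge0.
- have := H _ us.
  have -> : m - (y + s *: v) =
      m - ((1 - t) *: x + t *: y) - (s + (1 - t) * a) *: v.
    rewrite cE yE -!addrA; congr (_ + _); rewrite -!opprD; congr (- _).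
    rewrite -!addrA -!scalerDl; congr (_ + _ *: _); ring.
  have -> : x - (y + s *: v) = - ((a + s) *: v).
    by rewrite yE -addrA -scalerDl opprD addrA subrr add0r.
  rewrite (opprD y) (addrA y) subrr add0r !normrN !normrZ.
  rewrite !ger0_norm ?addr_ge0 //.
  by move=> /le_trans; apply; rewrite le_eqVlt; apply/orP; left; apply/eqP; ring.
have := H _ ur.
have -> : m - (x + r *: - v) =
    m - ((1 - t) *: x + t *: y) + (r + t * a) *: v.
  rewrite cE -!addrA; congr (_ + _); rewrite scalerN opprD opprK opprD -addrA.
  congr (_ + _); rewrite -scaleNr -scalerDl; congr (_ *: _); ring.
have -> : y - (x + r *: - v) = (a + r) *: v.
  by rewrite yE scalerN opprD opprK addrACA subrr add0r -scalerDl.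
rewrite scalerN subKr !normrZ !ger0_norm ?addr_ge0 //.
by move=> /le_trans; apply; rewrite le_eqVlt; apply/orP; left; apply/eqP; ring.
Qed.

End StrictConvexity.

(** * Coordinates in a space with a maximum norm *)

Section MaxNormCoordinates.
Context {R : realType} {I : Type} (Z : normedModType R).
Context (X : I -> normedModType R).
Context (p : forall i, {linear Z -> X i}) (inj : forall i, {linear X i -> Z}).

(** Common form of both sums, so that one argument covers them. Attainment of the norm holds for
    finite and c_0 sums but can fail for infinite l-infinity sums. *)
Record max_norm_coordinates : Prop := MaxNormCoordinates {
  coordK : forall i u, p i (inj i u) = u;
  coord_neq : forall i j u, i <> j -> p j (inj i u) = 0;
  norm_coord_le : forall i x, `|p i x| <= `|x|;
  norm_coord_attained : forall x, exists i, `|p i x| = `|x| }.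

Hypothesis C : max_norm_coordinates.

Lemma coord_ext x y : (forall i, p i x = p i y) -> x = y.
Proof.
move=> xy; have [i xyi] := norm_coord_attained C (x - y).
by apply/eqP; rewrite -subr_eq0 -normr_eq0 -xyi linearB xy subrr normr0.
Qed.

Lemma norm_inj i u : `|inj i u| = `|u|.
Proof.
apply/eqP; rewrite eq_le -[X in _ && (`|X| <= _)](coordK C).
rewrite (norm_coord_le C) andbT.
have [j <-] := norm_coord_attained C (inj i u).
have [ij|ij] := pselect (i = j); first by subst j; rewrite (coordK C).
by rewrite (coord_neq C) // normr0.
Qed.

Definition update k (u : X k) (x : Z) : Z := x + inj k (u - p k x).

Lemma coord_update k u x : p k (update k u x) = u.
Proof. by rewrite linearD (coordK C) subrKC. Qed.

Lemma coord_update_neq k j u x : k <> j -> p j (update k u x) = p j x.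
Proof. by move=> kj; rewrite linearD (coord_neq C) // addr0. Qed.

Lemma norm_update k u x : `|x| <= 1 -> `|u| = 1 -> `|update k u x| = 1.
Proof.
move=> x1 u1; have := norm_coord_le C k (update k u x).
rewrite coord_update u1 => ge1.
apply/eqP; rewrite eq_le ge1 andbT.
have [j <-] := norm_coord_attained C (update k u x).
have [kj|kj] := pselect (k = j); first by subst j; rewrite coord_update u1.
by rewrite coord_update_neq // (le_trans (norm_coord_le C _ _)).
Qed.

Lemma norm_inj_add j e z : p j z = 0 -> `|e| = 1 -> `|z| <= 1 ->
  `|inj j e + z| = 1.
Proof.
move=> pz e1 z1; rewrite -(norm_update j e z z1 e1) /update pz subr0.
by rewrite addrC.
Qed.

Hypothesis scX : forall i, strictly_convex (X i).

(** The norm 2 is attained at some coordinate, necessarily [k], since elsewhere only [y]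
    contributes; there the midpoint of [p k y] and [e] is a unit vector. *)
Lemma face_eq k (e : X k) y : `|e| = 1 -> `|y| = 1 -> `|y + inj k e| = 2 ->
  p k y = e.
Proof.
move=> e1 y1 ye.
have [i] := norm_coord_attained C (y + inj k e); rewrite ye linearD.
have yi1 j : `|p j y| <= 1 by rewrite -y1 (norm_coord_le C).
have [ki|ki] := pselect (k = i); last first.
  by rewrite (coord_neq C) // addr0 => yi; have := yi1 i;
     rewrite yi (ler_nat _ 2 1).
subst i; rewrite (coordK C) => ye2.
have t01 : 0 < (2^-1 : R) < 1 by lra.
apply: (strictly_convex_combination _ (scX k) _ _ _ _ ltr01 t01) => //.
  by rewrite e1.
have -> : 1 - 2^-1 = 2^-1 :> R by lra.
by rewrite -scalerDr normrZ ye2 ger0_norm //; lra.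
Qed.

Lemma opposite_faces_dist k y z : `|y| = 1 -> `|z| = 1 -> p k z = - p k y ->
  `|p k y| = 1 -> `|y - z| = 2.
Proof.
move=> y1 z1 zy yk1; apply/eqP; rewrite eq_le; apply/andP; split.
  by rewrite (le_trans (ler_normB _ _)) // y1 z1; lra.
apply: le_trans (norm_coord_le C k _); rewrite linearB zy opprK.
by rewrite -mulr2n normrMn yk1.
Qed.

(** * Images of faces under an isometry of unit spheres *)

Section Isometry.
Context (Y : normedModType R) (D : Z -> Y).
Hypothesis D_sphere : forall x, `|x| = 1 -> `|D x| = 1.
Hypothesis D_surj : forall y, `|y| = 1 -> exists2 x, `|x| = 1 & D x = y.
Hypothesis D_isom : forall x y, `|x| = 1 -> `|y| = 1 -> `|D x - D y| = `|x - y|.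

Definition face_image k (e : X k) (v : Y) : Prop :=
  exists x, [/\ `|x| = 1, p k x = e & D x = v].

Lemma norm_face_image k e v : face_image k e v -> `|v| = 1.
Proof. by case=> x [x1 _ <-]; exact: D_sphere. Qed.

Lemma face_image_center k (e : X k) : `|e| = 1 -> face_image k e (D (inj k e)).
Proof. by move=> e1; exists (inj k e); rewrite norm_inj (coordK C). Qed.

(** Carries [face_eq] over to [Y]: membership in a face image is read off from a single distance. *)
Lemma face_image_star k (e : X k) v : `|e| = 1 -> `|v| = 1 ->
  `|v - D (- inj k e)| = 2 -> face_image k e v.
Proof.
move=> e1 /D_surj[x x1 <-]; rewrite D_isom ?normrN ?norm_inj // opprK => xe.
by exists x; rewrite (face_eq k e x).
Qed.

Lemma face_image_dist k (e : X k) v w : `|e| = 1 ->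
  face_image k e v -> face_image k (- e) w -> `|v - w| = 2.
Proof.
move=> e1 [x [x1 xe <-]] [y [y1 ye <-]]; rewrite D_isom //.
by apply: (opposite_faces_dist k); rewrite ?xe.
Qed.

(** With w = D(-e), both h = (v - w)/2 and v have norm 1, while h - w + v = (3/2)(v - w) has norm 3;
    hence |h - w| = 2. *)
Lemma face_image_mid k (e : X k) v : `|e| = 1 -> face_image k e v ->
  face_image k e (2^-1 *: (v - D (- inj k e))).
Proof.
move=> e1 ve; have v1 := norm_face_image _ _ _ ve.
set w := D _; have w1 : `|w| = 1 by rewrite D_sphere // normrN norm_inj.
have vw : `|v - w| = 2.
  apply: face_image_dist ve _ => //; exists (- inj k e).
  by rewrite normrN norm_inj linearN (coordK C).
have h1 : `|2^-1 *: (v - w)| = 1 by rewrite normrZ vw ger0_norm //; lra.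
apply: face_image_star => //; rewrite -/w.
apply/eqP; rewrite eq_le; apply/andP; split.
  by rewrite (le_trans (ler_normB _ _)) // h1 w1; lra.
have := ler_normD (2^-1 *: (v - w) - w) v.
have -> : 2^-1 *: (v - w) - w + v = (2^-1 + 1) *: (v - w).
  by rewrite scalerDl scale1r -addrA [- w + v]addrC.
rewrite normrZ vw v1 ger0_norm; lra.
Qed.

(** [face_image_mid] for -e puts (w - y)/2 in the opposite face image, at distance 2 from v.
    Doubling, 4 = |(v + y) + (v - w)|, which forces |v + y| = 2. *)
Lemma face_image_opp k (e : X k) v : `|e| = 1 -> face_image k e v ->
  face_image k (- e) (- v).
Proof.
move=> e1 ve; have v1 := norm_face_image _ _ _ ve.
have e1' : `|- e| = 1 by rewrite normrN.
have w1 : `|D (inj k (- e))| = 1 by rewrite D_sphere // norm_inj.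
have y1 : `|D (inj k e)| = 1 by rewrite D_sphere // norm_inj.
have NiN : - inj k (- e) = inj k e by rewrite linearN opprK.
have := face_image_mid _ _ _ e1' (face_image_center _ _ e1').
rewrite NiN => /(face_image_dist _ _ _ _ e1 ve).
set w := D (inj k (- e)) in w1 *; set y := D (inj k e) in y1 *.
move=> vwy; have vy : `|v + y| = 2.
  apply/eqP; rewrite eq_le; apply/andP; split.
    by rewrite (le_trans (ler_normD _ _)) // v1 y1; lra.
  have := ler_normD (v + y) (v - w); have := ler_normB v w.
  have -> : v + y + (v - w) = 2 *: (v - 2^-1 *: (w - y)).
    rewrite scalerBr scalerA divff // scale1r opprB scaler_nat mulr2n.
    by rewrite addrACA.
  by rewrite normrZ vwy v1 w1 ger0_norm; lra.
apply: face_image_star => //; first by rewrite normrN.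
by rewrite NiN -opprD normrN.
Qed.

(** The point -(v - w)/2 lies in the opposite face image, hence at distance 2 from v'; doubling
    gives |v + v' - w| >= 3. *)
Lemma face_image_convex k (e : X k) v v' t : `|e| = 1 -> 0 <= t <= 1 ->
  face_image k e v -> face_image k e v' ->
  face_image k e ((1 - t) *: v + t *: v').
Proof.
move=> e1 /andP[t0 t1] ve v'e.
have v1 := norm_face_image _ _ _ ve; have v'1 := norm_face_image _ _ _ v'e.
have w1 : `|D (- inj k e)| = 1 by rewrite D_sphere // normrN norm_inj.
have := face_image_opp _ _ _ e1 (face_image_mid _ _ _ e1 ve).
move=> /(face_image_dist _ _ _ _ e1 v'e).
set w := D _ in w1 *; rewrite opprK => v'vw.
have sum3 : 3 <= `|v + v' - w|.
  have := ler_normD (v + v' - w) v'.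
  have -> : v + v' - w + v' = 2 *: (v' + 2^-1 *: (v - w)).
    rewrite scalerDr scalerA divff // scale1r scaler_nat mulr2n.
    by rewrite addrAC [v + v']addrC -!addrA; congr (_ + _); rewrite addrCA.
  by rewrite normrZ v'vw v'1 ger0_norm; lra.
set c := _ + _; have c1 : `|c| <= 1.
  rewrite (le_trans (ler_normD _ _)) // !normrZ v1 v'1 !ger0_norm ?subr_ge0 //.
  by lra.
have cw : `|c - w| = 2.
  apply/eqP; rewrite eq_le; apply/andP; split.
    by rewrite (le_trans (ler_normB _ _)) // w1; lra.
  (* The combination with swapped weights has norm at most 1 and adds up with [c] to v + v', which
     leaves at least 2 for |c - w|. *)
  have := ler_normD (c - w) (t *: v + (1 - t) *: v').
  have := ler_normD (t *: v) ((1 - t) *: v').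
  rewrite !normrZ v1 v'1 !ger0_norm ?subr_ge0 //.
  have -> : c - w + (t *: v + (1 - t) *: v') = v + v' - w; last by lra.
  rewrite addrAC /c addrACA -!scalerDl subrK [t + _]addrC subrK.
  by rewrite !scale1r.
apply: face_image_star => //; apply/eqP; rewrite eq_le c1 /=.
by have := ler_normB c w; rewrite w1 cw; lra.
Qed.

(** * Affinity on faces and oddness *)

Hypothesis X_neq0 : forall i, exists w : X i, w != 0.

(** Pulling v back to q in the face of u gives |p k m - u| <= |m - q| = |D m - v|, so each
    coordinate falls under [strictly_convex_determined]. *)
Lemma sphere_determined x y m t : `|x| = 1 -> `|y| = 1 -> `|m| = 1 ->
  0 <= t <= 1 ->
  (forall k (u : X k), `|u| = 1 -> exists2 v, face_image k u v &
    `|D m - v| <= (1 - t) * `|p k x - u| + t * `|p k y - u|) ->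
  m = (1 - t) *: x + t *: y.
Proof.
move=> x1 y1 m1 t01 H; apply: coord_ext => k; rewrite linearD !linearZ.
have [w w0] := X_neq0 k.
apply: (strictly_convex_determined _ (scX k) w) => //.
- by rewrite -x1 (norm_coord_le C).
- by rewrite -y1 (norm_coord_le C).
move=> u /H[_ [q [q1 <- <-]]]; apply: le_trans.
by rewrite D_isom // -linearB (norm_coord_le C).
Qed.

Lemma update_dist k (u : X k) x : `|x - update k u x| = `|p k x - u|.
Proof. by rewrite opprD addNKr normrN norm_inj distrC. Qed.

Lemma update_face k (u : X k) x : `|x| = 1 -> `|u| = 1 ->
  face_image k u (D (update k u x)).
Proof.
move=> x1 u1; exists (update k u x); rewrite coord_update norm_update ?x1 //.
Qed.

(** Convexity serves twice: in the common face it yields [m], and in every other face it supplies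
    the comparison point, the combination of the images of the updated [x] and [y]. *)
Lemma isometry_affine_on_face k x y t : `|x| = 1 -> `|y| = 1 ->
  p k x = p k y -> `|p k x| = 1 -> 0 <= t <= 1 ->
  D ((1 - t) *: x + t *: y) = (1 - t) *: D x + t *: D y.
Proof.
move=> x1 y1 xy xk1 t01.
have xF : face_image k (p k x) (D x) by exists x.
have yF : face_image k (p k x) (D y) by exists y.
have [m [m1 _ mE]] := face_image_convex _ _ _ _ _ xk1 t01 xF yF.
rewrite -mE; congr D; apply/esym/sphere_determined => // j u u1.
exists ((1 - t) *: D (update j u x) + t *: D (update j u y)).
  by apply: face_image_convex => //; apply: update_face.
rewrite mE opprD addrACA -!scalerBr (le_trans (ler_normD _ _)) // !normrZ.
have /andP[t0 t1] := t01; rewrite !ger0_norm ?subr_ge0 //.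
by rewrite !D_isom ?norm_update ?x1 ?y1 // !update_dist.
Qed.

(** By surjectivity -D(-x) = D z, and z = x follows from [sphere_determined] with t = 0;
    [face_image_opp] provides the comparison points. *)
Lemma isometry_odd x : `|x| = 1 -> D (- x) = - D x.
Proof.
move=> x1; have Nx1 : `|- x| = 1 by rewrite normrN.
have [|z z1 zE] := D_surj (- D (- x)); first by rewrite normrN D_sphere.
rewrite -[LHS]opprK -zE; congr (- D _).
have t01 : 0 <= (0 : R) <= 1 by lra.
have -> : x = (1 - 0) *: x + 0 *: x by rewrite -scalerDl subrK scale1r.
apply: sphere_determined => // k u u1.
have Nu1 : `|- u| = 1 by rewrite normrN.
exists (- D (update k (- u) (- x))).
  have := face_image_opp _ _ _ Nu1 (update_face _ _ _ Nx1 Nu1).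
  by rewrite opprK.
rewrite zE -opprD normrN D_isom ?norm_update ?Nx1 //.
rewrite update_dist linearN -opprD normrN.
by rewrite mul0r addr0 subr0 mul1r.
Qed.

Lemma isometry_midpoint k x y m : `|x| = 1 -> `|y| = 1 -> p k x = p k y ->
  `|p k x| = 1 -> x + y = 2 *: m -> D x + D y = 2 *: D m.
Proof.
move=> x1 y1 xy xk xym; have t01 : 0 <= (2^-1 : R) <= 1 by lra.
have := isometry_affine_on_face _ _ _ _ x1 y1 xy xk t01.
have -> : 1 - 2^-1 = 2^-1 :> R by lra.
rewrite -!scalerDr xym scalerA mulVf // scale1r => ->.
by rewrite scalerA mulfV // scale1r.
Qed.

(** * The positively homogeneous extension and its linearity *)

Definition homog_ext (x : Z) : Y := `|x| *: D (`|x|^-1 *: x).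

Lemma norm_normalize (x : Z) : x != 0 -> `| (`|x|^-1 *: x) | = 1.
Proof. by move=> x0; rewrite normrZ normfV normr_id mulVf ?normr_eq0. Qed.

Lemma extension_sphere x : `|x| = 1 -> homog_ext x = D x.
Proof. by move=> x1; rewrite /homog_ext x1 invr1 !scale1r. Qed.

(** The factor |0| makes the irrelevant value [D 0] harmless. *)
Lemma extension0 : homog_ext 0 = 0.
Proof. by rewrite /homog_ext normr0 scale0r. Qed.

Lemma norm_extension x : `|homog_ext x| = `|x|.
Proof.
have [->|x0] := eqVneq x 0; first by rewrite extension0 !normr0.
by rewrite /homog_ext normrZ normr_id D_sphere ?norm_normalize // mulr1.
Qed.

Lemma extensionZ a x : homog_ext (a *: x) = a *: homog_ext x.
Proof.
have [->|x0] := eqVneq x 0; first by rewrite scaler0 extension0 scaler0.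
have pos b y : 0 < b -> homog_ext (b *: y) = b *: homog_ext y.
  move=> b0; rewrite /homog_ext normrZ gtr0_norm // !scalerA invfM mulrAC.
  by rewrite mulVf ?gt_eqF // mul1r.
have [a0|a0|->] := ltgtP a 0; last by rewrite !scale0r extension0.
- rewrite -[a]opprK scaleNr -scalerN pos ?oppr_gt0 // [RHS]scaleNr -scalerN.
  congr (_ *: _).
  by rewrite /homog_ext normrN !scalerN isometry_odd ?norm_normalize // scalerN.
- exact: pos.
Qed.

(** The points e + z and e - z share a face at j and have midpoint e; e + z and z - e share a face
    where z attains its norm and have midpoint z. Adding the two midpoint identities cancels D(e -
    z) by oddness. *)
Lemma isometry_add_unit j e z : `|e| = 1 -> `|z| = 1 -> p j z = 0 ->
  D (inj j e + z) = D (inj j e) + D z.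
Proof.
move=> e1 z1 pz; have ie1 : `|inj j e| = 1 by rewrite norm_inj.
have pNz : p j (- z) = 0 by rewrite linearN pz oppr0.
have z1' : `|z| <= 1 by rewrite z1.
have Nz1' : `|- z| <= 1 by rewrite normrN z1.
have ez1 := norm_inj_add j e z pz e1 z1'.
have eNz1 := norm_inj_add j e (- z) pNz e1 Nz1'.
have h1 : D (inj j e + z) + D (inj j e - z) = 2 *: D (inj j e).
  apply: (isometry_midpoint j) => //.
  - by rewrite !linearD pz pNz.
  - by rewrite linearD pz addr0 (coordK C).
  - by rewrite addrACA subrr addr0 scaler_nat mulr2n.
have [i] := norm_coord_attained C z; rewrite z1 => zi.
have ji : j <> i.
  move=> ji; subst i; move: zi; rewrite pz normr0 => /eqP.
  by rewrite eq_sym oner_eq0.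
have h2 : D (inj j e + z) + D (- (inj j e - z)) = 2 *: D z.
  apply: (isometry_midpoint i) => //.
  - by rewrite normrN.
  - by rewrite opprB linearB linearD (coord_neq C) // add0r subr0.
  - by rewrite linearD (coord_neq C) // add0r.
  - by rewrite opprB addrC subrKA -mulr2n scaler_nat.
apply: (scalerI (a := 2 : R)); first by rewrite pnatr_eq0.
rewrite scalerDr -h1 -h2 isometry_odd // addrACA subrr addr0.
by rewrite scaler_nat mulr2n.
Qed.

(** Affinity on the segment from e to e + z/|z|, which lies in one face and contains e + z. *)
Lemma isometry_add j e z : `|e| = 1 -> `|z| <= 1 -> p j z = 0 ->
  D (inj j e + z) = D (inj j e) + homog_ext z.
Proof.
move=> e1 z1 pz; have ie1 : `|inj j e| = 1 by rewrite norm_inj.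
have [->|z0] := eqVneq z 0; first by rewrite extension0 !addr0.
have u1 := norm_normalize z z0; set u := _ *: z in u1.
have pu : p j u = 0 by rewrite linearZ /= pz scaler0.
have u1' : `|u| <= 1 by rewrite u1.
have zE : z = `|z| *: u.
  by rewrite scalerA mulfV ?normr_eq0 // scale1r.
have t01 : 0 <= `|z| <= 1 by rewrite normr_ge0.
have eE : inj j e + z = (1 - `|z|) *: inj j e + `|z| *: (inj j e + u).
  by rewrite scalerDr addrA -scalerDl subrK scale1r -zE.
rewrite eE (isometry_affine_on_face j) ?(norm_inj_add j) //.
- by rewrite isometry_add_unit // scalerDr addrA -scalerDl subrK scale1r.
- by rewrite linearD pu addr0.
- by rewrite (coordK C).
Qed.

(** Scaled by [r] into the unit ball and shifted by a unit vector in coordinate [j], x and y land in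
    one face, where the midpoint identity applies. The summand 1 in [r] covers x = y = 0. *)
Lemma extension_add_coord j x y : p j x = 0 -> p j y = 0 ->
  homog_ext (x + y) = homog_ext x + homog_ext y.
Proof.
move=> px py; have [w w0] := X_neq0 j.
pose e := `|w|^-1 *: w.
have e1 : `|e| = 1 by rewrite normrZ normfV normr_id mulVf ?normr_eq0.
have s0 : 0 < 1 + `|x| + `|y| by rewrite -addrA ltr_pwDl // addr_ge0.
pose r := (1 + `|x| + `|y|)^-1; have r0 : 0 < r by rewrite invr_gt0.
have small u : `|u| <= 1 + `|x| + `|y| -> `|r *: u| <= 1.
  by move=> ur; rewrite normrZ gtr0_norm // ler_pdivrMl // mulr1.
have pr u : p j u = 0 -> p j (r *: u) = 0.
  by move=> pu; rewrite linearZ /= pu scaler0.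
have rx1 : `|r *: x| <= 1.
  by apply: small; have := normr_ge0 y; lra.
have ry1 : `|r *: y| <= 1.
  by apply: small; have := normr_ge0 x; lra.
have rxy1 : `|2^-1 *: (r *: (x + y))| <= 1.
  rewrite normrZ ger0_norm ?invr_ge0 // scalerDr.
  by have := ler_normD (r *: x) (r *: y); lra.
have prxy : p j (2^-1 *: (r *: (x + y))) = 0.
  by rewrite linearZ /= pr ?scaler0 // linearD px py addr0.
have : D (inj j e + r *: x) + D (inj j e + r *: y) =
    2 *: D (inj j e + 2^-1 *: (r *: (x + y))).
  apply: (isometry_midpoint j); rewrite ?(norm_inj_add j) ?pr //.
  - by rewrite !linearD !pr.
  - by rewrite linearD pr // addr0 (coordK C).
  rewrite addrACA [RHS]scalerDr [2 *: (2^-1 *: _)]scalerA mulfV // scale1r.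
  by rewrite -scalerDr scaler_nat mulr2n.
rewrite !isometry_add ?pr // !extensionZ addrACA [RHS]scalerDr.
rewrite [2 *: (2^-1 *: _)]scalerA mulfV // scale1r.
rewrite -mulr2n -scaler_nat => /addrI.
by rewrite -scalerDr => /scalerI; rewrite gt_eqF // => /(_ isT).
Qed.

Lemma extension_split_attained j x : `|p j x| = `|x| ->
  homog_ext x = homog_ext (inj j (p j x)) + homog_ext (x - inj j (p j x)).
Proof.
have [->|x0] := eqVneq x 0.
  by rewrite !linear0 addr0 extension0 addr0.
move=> pjx; have nx0 : `|x|^-1 != 0 by rewrite invr_eq0 normr_eq0.
apply: (scalerI nx0); rewrite scalerDr -!extensionZ.
have x1 := norm_normalize x x0; set y := _ *: x in x1.
have py1 : `|p j y| = 1.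
  by rewrite linearZ /= normrZ pjx normfV normr_id mulVf ?normr_eq0.
have -> : `|x|^-1 *: inj j (p j x) = inj j (p j y) by rewrite !linearZ.
have -> : `|x|^-1 *: (x - inj j (p j x)) = y - inj j (p j y).
  by rewrite scalerBr !linearZ.
rewrite [LHS]extension_sphere // [X in X + _]extension_sphere ?norm_inj //.
rewrite -isometry_add //; first by rewrite subrKC.
- apply: le_trans (_ : 1 <= 1) => //.
  have [i <-] := norm_coord_attained C (y - inj j (p j y)).
  have [ji|ji] := pselect (j = i).
    by subst i; rewrite linearB (coordK C) subrr normr0.
  by rewrite linearB (coord_neq C) // subr0 -x1 (norm_coord_le C).
- by rewrite linearB (coordK C) subrr.
Qed.

(** Peel off a coordinate j attaining the norm, split off coordinate i within {z_j = 0}, then put a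
    and the rest together again within {z_i = 0}. *)
Lemma extension_split i x :
  homog_ext x = homog_ext (inj i (p i x)) + homog_ext (x - inj i (p i x)).
Proof.
have [j jx] := norm_coord_attained C x.
have [ji|ji] := pselect (j = i).
  by subst j; exact: extension_split_attained.
rewrite (extension_split_attained j) //.
set a := inj j _; set b := inj i _.
have pja : p j (x - a) = 0 by rewrite linearB (coordK C) subrr.
have pjb : p j b = 0 by rewrite (coord_neq C) //; exact: nesym.
have pjxab : p j (x - a - b) = 0 by rewrite linearB pja pjb subrr.
have pia : p i a = 0 by rewrite (coord_neq C).
have pixab : p i (x - a - b) = 0.
  by rewrite !linearB pia (coordK C) subr0 subrr.
have -> : homog_ext (x - a) = homog_ext b + homog_ext (x - a - b).
  by rewrite -(extension_add_coord j) // subrKC.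
have -> : x - b = a + (x - a - b) by rewrite addrAC subrKC.
by rewrite (extension_add_coord i a) // addrCA.
Qed.

Hypothesis two_coords : exists i j : I, i <> j.

(** After splitting at i, the coordinate parts add within {z_j = 0} and the remainders within {z_i =
    0}. *)
Lemma extensionD x y : homog_ext (x + y) = homog_ext x + homog_ext y.
Proof.
have [i [j ij]] := two_coords.
rewrite (extension_split i) (extension_split i x) (extension_split i y).
rewrite addrACA !linearD (extension_add_coord j) ?(coord_neq C) //.
congr (_ + _); rewrite -(extension_add_coord i).
- by rewrite addrACA.
- by rewrite linearB (coordK C) subrr.
- by rewrite linearB (coordK C) subrr.
Qed.

Lemma extension_surj y : exists x, homog_ext x = y.
Proof.
have [->|y0] := eqVneq y 0; first by exists 0; exact: extension0.
have [|x x1 xE] := D_surj (`|y|^-1 *: y).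
  by rewrite normrZ normfV normr_id mulVf ?normr_eq0.
exists (`|y| *: x); rewrite extensionZ extension_sphere // xE.
by rewrite scalerA mulfV ?normr_eq0 // scale1r.
Qed.

Lemma extension_linear : linear homog_ext.
Proof. by move=> a x y; rewrite extensionD extensionZ. Qed.

End Isometry.

Lemma max_norm_coordinates_Mazur_Ulam :
  (forall i, exists w : X i, w != 0) -> (exists i j : I, i <> j) ->
  Mazur_Ulam_property Z.
Proof.
move=> X_neq0 two Y D Dsph Dsurj Disom.
pose T : {linear Z -> Y} := HB.pack (homog_ext Y D)
  (GRing.isLinear.Build R Z Y *:%R _
    (extension_linear Y D Dsph Dsurj Disom X_neq0 two)).
exists T; split.
- exact: extension_surj.
- exact: norm_extension.
- exact: extension_sphere.
Qed.

End MaxNormCoordinates.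

(** * Coordinates of the finite sum and of the c_0 sum *)

Lemma dfwith0_linear {R : realType} {I : eqType} (X : I -> lmodType R)
    (i j : I) (a : R) (u v : X i) :
  dfwith (fun k => 0 : X k) i (a *: u + v) j =
  a *: dfwith (fun k => 0 : X k) i u j + dfwith (fun k => 0 : X k) i v j.
Proof.
have [ij|ij] := eqVneq i j; first by subst j; rewrite !dfwithin.
by rewrite !dfwithout // scaler0 addr0.
Qed.

Section LinfSumCoordinates.
Context {R : realType} (X : nat -> normedModType R) (n : nat).

Definition linf_coord (i : 'I_n) (x : linf_sum X n) : X i := x i.

Lemma linf_coord_linear i : linear (linf_coord i).
Proof. by []. Qed.

HB.instance Definition _ (i : 'I_n) :=
  GRing.isLinear.Build R (linf_sum X n) (X i) *:%R
    (linf_coord i) (linf_coord_linear i).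

Definition linf_inj (i : 'I_n) (u : X i) : linf_sum X n :=
  dfwith (fun k : 'I_n => 0 : X k) i u.

Lemma linf_inj_linear i : linear (linf_inj i).
Proof.
move=> a u v; apply: functional_extensionality_dep => j.
exact: (dfwith0_linear (fun k : 'I_n => X k)).
Qed.

HB.instance Definition _ (i : 'I_n) :=
  GRing.isLinear.Build R (X i) (linf_sum X n) *:%R
    (linf_inj i) (linf_inj_linear i).

Lemma linf_max_norm_coordinates : (0 < n)%N ->
  max_norm_coordinates (linf_sum X n) (fun i : 'I_n => X i) linf_coord linf_inj.
Proof.
move=> n0; split.
- by move=> i u; exact: dfwithin.
- by move=> i j u /eqP ij; exact: dfwithout.
- by move=> i x; exact: (le_bigmax 0 (fun i => `|x i|)).
move=> x.
(* The default 0 of the maximum lies below every norm, so some index attains the maximum. *)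
have [i _ xi] := @eq_bigmax _ _ _ 0 (Ordinal n0) xpredT (fun i : 'I_n => `|x i|)
  isT (fun i _ => normr_ge0 (x i)).
by exists i; rewrite /linf_coord -xi.
Qed.

End LinfSumCoordinates.

Section C0SumCoordinates.
Context {R : realType} (X : nat -> normedModType R).

Definition c0_coord (i : nat) (x : c0_sum X) : X i := c0val x i.

Lemma c0_coord_linear i : linear (c0_coord i).
Proof. by []. Qed.

HB.instance Definition _ i :=
  GRing.isLinear.Build R (c0_sum X) (X i) *:%R (c0_coord i) (c0_coord_linear i).

Lemma dfwith0_cvg0 (i : nat) (u : X i) :
  (fun k => `|dfwith (fun k => 0 : X k) i u k|) @ \oo --> (0 : R).
Proof.
apply/cvgrPdist_le => e e0; exists i.+1 => // k /= ik.
by rewrite dfwithout ?ltn_eqF // normr0 subrr normr0 ltW.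
Qed.

Definition c0_inj (i : nat) (u : X i) : c0_sum X := C0sum (dfwith0_cvg0 i u).

Lemma c0_inj_linear i : linear (c0_inj i).
Proof.
move=> a u v; apply: c0_sum_inj; apply: functional_extensionality_dep => j.
exact: (dfwith0_linear X).
Qed.

HB.instance Definition _ i :=
  GRing.isLinear.Build R (X i) (c0_sum X) *:%R (c0_inj i) (c0_inj_linear i).

Lemma c0_norm_coord_le i (x : c0_sum X) : `|c0_coord i x| <= `|x|.
Proof.
apply: sup_upper_bound; last by exists i.
split; first by exists `|c0val x 0|, 0%N.
have [M [_ HM]] := cvg_seq_bounded (cvgP _ (c0valP x)).
exists (M + 1) => _ [k _ <-].
by have := HM (M + 1) (ltr_pwDr ltr01 (lexx _)) k I; rewrite /= normr_id.
Qed.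

(** For x nonzero, all but finitely many coordinates have norm below |x|/2, so the supremum is a
    maximum over finitely many. *)
Lemma c0_norm_coord_attained (x : c0_sum X) : exists i, `|c0_coord i x| = `|x|.
Proof.
have [->|x0] := eqVneq x 0.
  by exists 0%N; rewrite !normr0.
have nx : 0 < `|x| / 2 by rewrite divr_gt0 // normr_gt0.
have /cvgrPdist_lt/(_ _ nx)[N _ HN] := c0valP x.
(* Taking [N.+1] indices keeps the range inhabited even when N = 0. *)
have [i _ xi] := @eq_bigmax _ _ _ 0 (@ord0 N) xpredT
  (fun i : 'I_N.+1 => `|c0_coord i x|) isT
  (fun i _ => normr_ge0 (c0_coord i x)).
exists i; apply/eqP; rewrite eq_le c0_norm_coord_le /=.
have : `|x| <= Num.max (`|x| / 2) `|c0_coord i x|.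
  apply: ge_sup; first by exists `|c0val x 0|, 0%N.
  move=> _ [k _ <-]; rewrite le_max; apply/orP.
  have [kN|Nk] := ltnP k N.+1.
    right; rewrite -xi.
    exact: (le_bigmax 0 (fun i : 'I_N.+1 => `|c0_coord i x|) (Ordinal kN)).
  left; have := HN k (ltnW Nk); rewrite /= sub0r normrN normr_id.
  exact: ltW.
rewrite le_max => /orP[|//]; have : 0 < `|x| by rewrite normr_gt0.
lra.
Qed.

Lemma c0_max_norm_coordinates :
  max_norm_coordinates (c0_sum X) X c0_coord c0_inj.
Proof.
split.
- by move=> i u; exact: dfwithin.
- by move=> i j u /eqP ij; exact: dfwithout.
- exact: c0_norm_coord_le.
- exact: c0_norm_coord_attained.
Qed.

End C0SumCoordinates.

Theorem theorem3p6 (R : realType) (X : nat -> completeNormedModType R) :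
  (forall k : nat, strictly_convex (X k)) ->
  (forall k : nat, dim_ge2 (X k)) ->
  (forall n : nat, (2 <= n)%N -> Mazur_Ulam_property (linf_sum X n)) /\
  Mazur_Ulam_property (c0_sum X).
Proof.
move=> scX dimX.
have X_neq0 k : exists w : X k, w != 0.
  have [w [w' ww']] := dimX k; exists w; apply/eqP => w0.
  have [|/eqP] := ww' 1 0; first by rewrite w0 scaler0 scale0r addr0.
  by rewrite oner_eq0.
split=> [n n2|].
- have n0 : (0 < n)%N by exact: ltnW.
  apply: (max_norm_coordinates_Mazur_Ulam _ _ _ _
    (linf_max_norm_coordinates _ _ n0)) => [i|i|]; [exact: scX|exact: X_neq0|].
  by exists (Ordinal n0), (Ordinal n2).
- apply: (max_norm_coordinates_Mazur_Ulam _ _ _ _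
    (c0_max_norm_coordinates _)) => //.
  by exists 0%N, 1%N.
Qed.
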